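(* Let $\mathcal H$ be a real Hilbert space and $f:\mathcal H\to\mathbb R\cup\{+\infty\}$ a proper closed convex function. Let $x_0\in\mathrm{dom}(f)$, $\sigma\in[0,1[$, $\theta>0$, and let $\{x_k\},\{v_k\},\{\varepsilon_k\},\{\lambda_k\}$ be infinite sequences generated by Algorithm 1 (defined in the context). Assume that $\mathcal D_0<\infty$, where $$\mathcal D_0=\sup\{\|x-y\|:\ \max\{f(x),f(y)\}\le f(x_0)\},$$ and that $\varepsilon_k=0$ for all $k\ge1$. Let $\bar x$ be a minimizer of $f$ and define $$\kappa_0=\sqrt{\frac{\theta(1-\sigma)}{\mathcal D_0^3}}.$$ Then, for all $k\ge1$: (a) $\|v_k\|\,\mathcal D_0\ge f(x_k)-f(\bar x)$; (b) $f(x_k)\le f(x_{k-1})-\dfrac{2\kappa_0(f(x_{k-1})-f(\bar x))^{3/2}}{2+3\kappa_0(f(x_{k-1})-f(\bar x))^{1/2}}$; (c) $f(x_k)-f(\bar x)\le\dfrac{f(x_0)-f(\bar x)}{\left[1+k\dfrac{\kappa_0\sqrt{f(x_0)-f(\bar x)}}{2+3\kappa_0\sqrt{f(x_0)-f(\bar x)}}\right]^2}=\mathcal O(1/k^2)$. Moreover, for each $k\ge2$ even, there exists $j\in\{k/2+1,\dots,k\}$ such that $$\|v_j\|\le\frac4{\sqrt[3]{\theta(1-\sigma)}}\left[\frac{f(x_0)-f(\bar x)}{k\left[2+k\dfrac{\kappa_0\sqrt{f(x_0)-f(\bar x)}}{2+3\kappa_0\sqrt{f(x_0)-f(\bar x)}}\right]^2}\right]^{2/3}=\mathcal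 O(1/k^2).$$
   Context: For $\varepsilon\ge0$ and $y\in\mathrm{dom}(f)$, $v\in\partial_\varepsilon f(y)$ means $f(x')\ge f(y)+\langle v,x'-y\rangle-\varepsilon$ for all $x'\in\mathcal H$ (so $\partial_0f=\partial f$). Algorithm 1 (large-step proximal point method for minimizing $f$): given $x_0\in\mathrm{dom}(f)$, $\sigma\in[0,1[$, $\theta>0$, at each iteration $k=1,2,\dots$ choose $\lambda_k>0$ and find $x_k,v_k\in\mathcal H$, $\varepsilon_k\ge0$ such that $$v_k\in\partial_{\varepsilon_k}f(x_k),\qquad \|\lambda_kv_k+x_k-x_{k-1}\|^2+2\lambda_k\varepsilon_k\le\sigma^2\|x_k-x_{k-1}\|^2,$$ $$\lambda_k\|x_k-x_{k-1}\|\ge\theta\ \text{ or }\ v_k=0;$$ if $v_k=0$ the algorithm stops, otherwise it proceeds to iteration $k+1$. The sequences being infinite means that $v_k\ne0$ for all $k\ge1$. *)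

(* Defs.v *)
From HB Require Import structures.
From mathcomp Require Import all_boot all_order all_algebra sesquilinear.
From mathcomp Require Import all_classical all_reals all_analysis.

Set Implicit Arguments.
Unset Strict Implicit.
Unset Printing Implicit Defensive.

Import Order.TTheory GRing.Theory Num.Theory.
Import numFieldNormedType.Exports.

Local Open Scope classical_set_scope.
Local Open Scope ring_scope.

(* A real Hilbert space is a complete normed space [H] over the reals together
   with a symmetric positive definite form [inner : {dot H for idfun}] that
   induces the norm of [H]. *)
Definition induces_norm (R : realType) (H : completeNormedModType R)
    (inner : {dot H for idfun}) : Prop :=
  forall x : H, inner x x = `|x| ^+ 2.

Section ConvexAnalysis.
Context {R : realType} {H : completeNormedModType R}.
Implicit Types (f : H -> \bar R) (x y v : H).
Local Open Scope ereal_scope.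

Definition dom f : set H := [set x | f x < +oo].

Definition proper_function f : Prop :=
  (forall x, -oo < f x) /\ dom f !=set0.

Definition epigraph f : set (H * R) := [set p | f p.1 <= p.2%:E].

Definition closed_function f : Prop := closed (epigraph f).

(* For proper [f] the right-hand side is never of the form +oo - oo. *)
Definition convex_extended f : Prop :=
  forall x y (t : R), (0 < t < 1)%R ->
    f (t *: x + (1 - t) *: y)%R <= t%:E * f x + (1 - t)%:E * f y.

Definition minimizer f x : Prop := forall y, f x <= f y.

Definition eps_subdifferential (inner : {dot H for idfun}) f (e : R) y
    : set H :=
  [set v | y \in dom f /\
     forall x', f y + (inner v (x' - y)%R)%:E - e%:E <= f x'].

Definition sublevel_diameter f x0 : \bar R :=
  ereal_sup [set `|p.1 - p.2|%:E |
             p in [set p : H * H | maxe (f p.1) (f p.2) <= f x0]].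

End ConvexAnalysis.

(* The sequences [v], [eps], [lam] are indexed from 1; their values at 0 are
   irrelevant.  The stopping test never succeeds, since the run is infinite. *)
Record infinite_large_step_run (R : realType) (H : completeNormedModType R)
    (inner : {dot H for idfun}) (f : H -> \bar R) (x0 : H) (sigma theta : R)
    (x v : nat -> H) (eps lam : nat -> R) : Prop := InfiniteLargeStepRun {
  run_start : x 0%N = x0 ;
  run_step_gt0 : forall k, (1 <= k)%N -> 0 < lam k ;
  run_eps_ge0 : forall k, (1 <= k)%N -> 0 <= eps k ;
  run_subgradient : forall k, (1 <= k)%N ->
    v k \in eps_subdifferential inner f (eps k) (x k) ;
  run_error : forall k, (1 <= k)%N ->
    `|lam k *: v k + x k - x k.-1| ^+ 2 + 2 * lam k * eps k
      <= sigma ^+ 2 * `|x k - x k.-1| ^+ 2 ;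
  run_large_step : forall k, (1 <= k)%N ->
    theta <= lam k * `|x k - x k.-1| \/ v k = 0 ;
  run_never_stops : forall k, (1 <= k)%N -> v k <> 0
}.

(* Main.v *)
Require Import Defs.
From mathcomp Require Import all_boot all_order all_algebra sesquilinear.
From mathcomp Require Import all_classical all_reals all_analysis.
From mathcomp Require Import ring lra.
Import Order.TTheory GRing.Theory Num.Theory.
Import numFieldNormedType.Exports.
Local Open Scope classical_set_scope.
Local Open Scope ring_scope.

(** One step of the method gains a fixed power of the norm of the subgradient.
    With d = x_(k-1) - x_k, the error criterion says that lambda v_k is within
    sigma |d| of d.  Expanding the square gives
    2 <v_k, d> >= |v_k| (lambda |v_k| + (1 - sigma) |d|), and by the
    arithmetic-geometric mean inequality and lambda |d| >= theta the bracket is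
    at least 2 sqrt(theta (1 - sigma) |v_k|).  Since v_k is an exact subgradient,
    f decreases by at least sqrt(theta (1 - sigma)) |v_k|^(3/2)
    ([large_step_decrease], [gap_decrease]).

    The iterates never leave the initial sublevel set, so the subgradient
    inequality at the minimizer and Cauchy-Schwarz bound the gap in function
    values by D0 |v_k| ([gap_le_subgradient]).  Inserted in the decrease, this
    yields, for the gaps a = f(x_(k-1)) - f(xbar) and b = f(x_k) - f(xbar), the
    implicit recursion b + kappa0 b^(3/2) <= a ([gap_recursion]).  In the
    variables p = sqrt a and q = sqrt b it is polynomial: solving it for q^2
    gives the one-step estimate ([cubic_step_decrease]), and taking a square
    root gives q (1 + c p) <= p with c = kappa0 / (2 + 3 kappa0 p_0), that is
    1/q >= 1/p + c ([sqrt_step_decrease]).  Hence 1/p_k grows linearly in k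
    ([harmonic_decay]), so the gap p_k^2 is of order 1/k^2.

    For the subgradients, the decreases of f over the k/2 last steps sum to at
    most the gap at step k/2, itself of order 1/k^2.  One of these decreases is
    at most their mean, of order 1/k^3, and it dominates a multiple of
    |v_j|^(3/2) ([exists_small_decrement]); raising to the power 2/3 gives the
    order 1/k^2. *)

Set Implicit Arguments.
Unset Strict Implicit.

(** * The gain of a large step in a Hilbert space *)

Section InnerProduct.
Context (R : realType) (H : completeNormedModType R).
Context (inner : {dot H for idfun}) (hinner : induces_norm inner).
Implicit Types u w d v : H.

Lemma innerC u w : inner u w = inner w u.
Proof. by rewrite hermC expr0 mul1r. Qed.

Lemma innerZl (a : R) u w : inner (a *: u) w = a * inner u w.
Proof. by rewrite linearZl_LR. Qed.

Lemma innerZr (a : R) u w : inner u (a *: w) = a * inner u w.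
Proof. by rewrite innerC innerZl innerC. Qed.

Lemma sqr_normB u w :
  `|u - w| ^+ 2 = `|u| ^+ 2 + `|w| ^+ 2 - 2 * inner u w.
Proof.
rewrite -!hinner linearBl !linearBr /= (innerC w u); ring.
Qed.

(** Cauchy-Schwarz, read off from the squared norm of |w| u - |u| w. *)
Lemma inner_le_norm u w : inner u w <= `|u| * `|w|.
Proof.
have [->|u0] := eqVneq u 0; first by rewrite linear0l normr0 mul0r.
have [->|w0] := eqVneq w 0; first by rewrite linear0r normr0 mulr0.
have uw_gt0 : 0 < `|u| * `|w| by rewrite mulr_gt0 ?normr_gt0.
have := sqr_ge0 `| `|w| *: u - `|u| *: w |.
rewrite sqr_normB -!hinner !(innerZl, innerZr) !hinner.
rewrite -(ler_pM2l uw_gt0); nra.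
Qed.

(** The cube of a square root stands for the power 3/2, so that this bound and
    the recursion that follows from it stay polynomial. *)
Lemma large_step_decrease v d (lam sigma theta : R) :
    0 <= sigma < 1 -> 0 < theta -> 0 < lam ->
    `|lam *: v - d| ^+ 2 <= sigma ^+ 2 * `|d| ^+ 2 ->
    theta <= lam * `|d| ->
  Num.sqrt (theta * (1 - sigma)) * Num.sqrt `|v| ^+ 3 <= inner v d.
Proof.
move=> /andP[s0 s1] th0 l0 herr hstep.
have lvE : `|lam *: v| = lam * `|v| by rewrite normrZ gtr0_norm.
have hsplit := herr; rewrite sqr_normB lvE innerZl in hsplit.
have vE := sqr_sqrtr (normr_ge0 v).
set s : R := Num.sqrt `|v| in vE *.
have s_ge0 : 0 <= s := sqrtr_ge0 _.
have mE : Num.sqrt (theta * (1 - sigma)) ^+ 2 = theta * (1 - sigma).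
  by rewrite sqr_sqrtr// mulr_ge0 ?subr_ge0// ltW.
set m : R := Num.sqrt _ in mE *.
have m_ge0 : 0 <= m := sqrtr_ge0 _.
have d_ge0 := normr_ge0 d.
have v_ge0 := normr_ge0 v.
have lv_le : lam * `|v| <= (1 + sigma) * `|d|.
  have -> : lam * `|v| = `|(lam *: v - d) + d| by rewrite subrK.
  rewrite mulrDl mul1r addrC (le_trans (ler_normD _ _))//.
  rewrite lerD2l.
  by rewrite -(@ler_pXn2r _ 2%N) ?nnegrE ?mulr_ge0// exprMn.
(* The factor 1 - sigma ^+ 2 left by the expansion splits: 1 + sigma is
   absorbed by the upper bound [lv_le] on lam * `|v|, and 1 - sigma remains. *)
have ip2 : `|v| * (lam * `|v| + (1 - sigma) * `|d|) <= 2 * inner v d.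
  rewrite -(ler_pM2l l0).
  have : (lam * `|v|) * ((1 - sigma) * `|d|)
           <= (1 + sigma) * `|d| * ((1 - sigma) * `|d|).
    by rewrite ler_wpM2r// mulr_ge0// subr_ge0 ltW.
  nra.
(* Arithmetic-geometric mean inequality for the two terms on the right. *)
have ams : 2 * (m * s) <= lam * `|v| + (1 - sigma) * `|d|.
  have sig_ge0 : 0 <= 1 - sigma by rewrite subr_ge0 ltW.
  rewrite -(@ler_pXn2r _ 2%N) ?nnegrE ?addr_ge0 ?mulr_ge0 ?(ltW l0)//.
  have : (m * s) ^+ 2 <= (lam * `|v|) * ((1 - sigma) * `|d|).
    rewrite exprMn mE vE.
    have : 0 <= (lam * `|d| - theta) * ((1 - sigma) * `|v|).
      by rewrite !mulr_ge0// subr_ge0.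
    nra.
  move: (lam * `|v|) ((1 - sigma) * `|d|) (m * s) => A B C hAB.
  by have := sqr_ge0 (A - B); nra.
have : `|v| * (2 * (m * s)) <= 2 * inner v d.
  by apply: le_trans ip2; rewrite ler_wpM2l.
rewrite -vE mulrCA ler_pM2l// => /(le_trans _); apply.
by rewrite exprSr mulrCA.
Qed.

End InnerProduct.

(** * Recursive inequalities between nonnegative numbers *)

Section RealRecursion.
Context (R : realFieldType).
Implicit Types (kappa p q c : R) (g s : nat -> R).

(** The left side of the hypothesis increases with q, so it suffices that the
    claimed bound B on q^2 satisfies B + kappa B^(3/2) >= p^2.  With
    u = kappa p this reduces to (2 + u)^3 >= 4 (2 + 3u), where the terms of
    degree at most 1 agree: this is the origin of the coefficients 2 and 3.
    Sixth powers of p and q replace the fractional exponents. *)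
Lemma cubic_step_decrease kappa p q : 0 <= kappa -> 0 <= p -> 0 <= q ->
    q ^+ 2 + kappa * q ^+ 3 <= p ^+ 2 ->
  q ^+ 2 <= p ^+ 2 - 2 * kappa * p ^+ 3 / (2 + 3 * kappa * p).
Proof.
move=> k0 p0 q0 hpq.
have kp0 : 0 <= kappa * p by rewrite mulr_ge0.
have D0 : 0 < 2 + 3 * kappa * p by rewrite -mulrA; lra.
set B := (X in _ <= X).
have BE : B = p ^+ 2 * (2 + kappa * p) / (2 + 3 * kappa * p).
  by rewrite /B; field; rewrite gt_eqF.
have B_ge0 : 0 <= B by rewrite BE divr_ge0 ?mulr_ge0// ?ltW// ?sqr_ge0//; lra.
rewrite leNgt; apply/negP => Bq.
have [k_eq0|k_neq0] := eqVneq kappa 0.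
  move: Bq; rewrite BE k_eq0 mul0r mulr0 mul0r !addr0 mulfK ?pnatr_eq0// ltNge => /negP; apply.
  by move: hpq; rewrite k_eq0 mul0r addr0.
have k_gt0 : 0 < kappa by rewrite lt_neqAle eq_sym k_neq0.
have q3 : q ^+ 3 < 2 * p ^+ 3 / (2 + 3 * kappa * p).
  rewrite -(ltr_pM2l k_gt0).
  have -> : kappa * (2 * p ^+ 3 / (2 + 3 * kappa * p)) = p ^+ 2 - B.
    by rewrite /B; field; rewrite gt_eqF.
  lra.
have lt6 : (q ^+ 3) ^+ 2 < (2 * p ^+ 3 / (2 + 3 * kappa * p)) ^+ 2.
  by rewrite ltr_pXn2r// nnegrE ?exprn_ge0// divr_ge0 ?mulr_ge0 ?exprn_ge0// ltW.
have gt6 : B ^+ 3 < (q ^+ 2) ^+ 3.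
  by rewrite ltr_pXn2r// nnegrE exprn_ge0.
have : (2 * p ^+ 3 / (2 + 3 * kappa * p)) ^+ 2 <= B ^+ 3.
  rewrite -subr_ge0.
  have -> : B ^+ 3 - (2 * p ^+ 3 / (2 + 3 * kappa * p)) ^+ 2 =
      p ^+ 6 * (6 * (kappa * p) ^+ 2 + (kappa * p) ^+ 3)
        / (2 + 3 * kappa * p) ^+ 3.
    by rewrite BE; field; rewrite gt_eqF.
  rewrite divr_ge0 ?exprn_ge0 ?(ltW D0)// mulr_ge0 ?exprn_ge0//.
  by rewrite addr_ge0 ?mulr_ge0 ?exprn_ge0.
rewrite -!exprM in lt6 gt6 *; lra.
Qed.

(** Squaring, and writing u = kappa p, this is
    (2 + u) (2 + 4u)^2 <= (2 + 3u)^3. *)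
Lemma sqrt_step_decrease kappa p q : 0 <= kappa -> 0 <= p -> 0 <= q ->
    q ^+ 2 <= p ^+ 2 - 2 * kappa * p ^+ 3 / (2 + 3 * kappa * p) ->
  q * (1 + kappa * p / (2 + 3 * kappa * p)) <= p.
Proof.
move=> k0 p0 q0 hpq.
have kp0 : 0 <= kappa * p by rewrite mulr_ge0.
have D0 : 0 < 2 + 3 * kappa * p by rewrite -mulrA; lra.
have t0 : 0 <= kappa * p / (2 + 3 * kappa * p) by rewrite divr_ge0// ltW.
rewrite -(@ler_pXn2r _ 2%N) ?nnegrE ?mulr_ge0 ?addr_ge0// exprMn.
apply: (@le_trans _ _ ((p ^+ 2 - 2 * kappa * p ^+ 3 / (2 + 3 * kappa * p))
  * (1 + kappa * p / (2 + 3 * kappa * p)) ^+ 2)).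
  by rewrite ler_wpM2r// sqr_ge0.
rewrite -subr_ge0.
set X := (X in 0 <= X).
have -> : X = p ^+ 2 * (6 * (kappa * p) ^+ 2 + 11 * (kappa * p) ^+ 3)
        / (2 + 3 * kappa * p) ^+ 3.
  by rewrite /X; field; rewrite gt_eqF.
rewrite divr_ge0 ?exprn_ge0 ?(ltW D0)// mulr_ge0 ?exprn_ge0//.
by rewrite addr_ge0 ?mulr_ge0 ?exprn_ge0.
Qed.

(** For positive p the step says 1/p_(k+1) >= 1/p_k + c, and the conclusion is
    the sum of these.  The multiplied-out form also covers zero terms. *)
Lemma harmonic_decay c (p : nat -> R) : 0 <= c -> (forall k, 0 <= p k) ->
    (forall k, p k.+1 * (1 + c * p k) <= p k) ->
  forall k, p k * (1 + k%:R * (c * p 0%N)) <= p 0%N.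
Proof.
move=> c0 p0 step; elim=> [|k IH]; first by rewrite mul0r addr0 mulr1.
have [pk0|pk0] := eqVneq (p k) 0.
  have := step k; rewrite pk0 mulr0 addr0 mulr1 => pk1.
  have -> : p k.+1 = 0 by apply/eqP; rewrite eq_le pk1 p0.
  by rewrite mul0r.
have pk_gt0 : 0 < p k by rewrite lt_neqAle eq_sym pk0 p0.
rewrite -(ler_pM2l pk_gt0) -natr1.
have h1 : p k.+1 * (p k * (1 + k%:R * (c * p 0%N))) <= p k.+1 * p 0%N.
  by rewrite ler_wpM2l.
have h2 : p 0%N * (p k.+1 * (1 + c * p k)) <= p 0%N * p k.
  by rewrite ler_wpM2l.
lra.
Qed.

(** Summing the steps h+1, ..., h+n bounds the sum of the s_j by g_h, and the
    least of the n terms is at most their mean. *)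
Lemma exists_small_decrement g s (h n : nat) : (0 < n)%N ->
    (forall k, 0 <= g k) -> (forall k, g k.+1 + s k.+1 <= g k) ->
  exists j, (h + 1 <= j <= h + n)%N /\ n%:R * s j <= g h.
Proof.
move=> n0 g0 step; apply: contrapT => none.
have big i : (i < n)%N -> g h < n%:R * s (h + i).+1.
  move=> lt_in; rewrite ltNge; apply/negP => ?; apply: none.
  exists (h + i).+1; split=> //.
  by rewrite addn1 ltnS leq_addr -addnS leq_add2l.
have dec i := ler_wpM2l (ler0n R n) (step (h + i)%N).
have tele i : (i < n)%N -> n%:R * g (h + i).+1 < (n%:R - i.+1%:R) * g h.
  elim: i => [|i IH] lt_in.
    by have := big _ lt_in; have := dec 0%N; rewrite addn0; lra.
  have := big _ lt_in; have := dec i.+1; have := IH (ltnW lt_in).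
  rewrite !addnS -(natr1 i.+1); lra.
have := tele n.-1; rewrite prednK// leqnn subrr mul0r => /(_ isT).
by rewrite ltNge mulr_ge0.
Qed.

End RealRecursion.

(** * Rates for the gap in function values *)

Section GapRates.
Context (R : rcfType) (kappa : R) (g : nat -> R).
Context (kappa_ge0 : 0 <= kappa) (g_ge0 : forall k, 0 <= g k).
Context (g_step : forall k, g k.+1 + kappa * Num.sqrt (g k.+1) ^+ 3 <= g k).

Lemma gap_step_bound k :
  g k.+1 <= g k - 2 * kappa * Num.sqrt (g k) ^+ 3
                    / (2 + 3 * kappa * Num.sqrt (g k)).
Proof.
have gE i : g i = Num.sqrt (g i) ^+ 2 by rewrite sqr_sqrtr.
rewrite {1}(gE k.+1) {1}(gE k) cubic_step_decrease ?sqrtr_ge0//.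
by rewrite -!gE.
Qed.

Lemma gap_rate_bound k :
  g k <= g 0%N / (1 + k%:R * (kappa * Num.sqrt (g 0%N)
                        / (2 + 3 * kappa * Num.sqrt (g 0%N)))) ^+ 2.
Proof.
pose p i := Num.sqrt (g i).
have p_ge0 i : 0 <= p i by exact: sqrtr_ge0.
have gE i : g i = p i ^+ 2 by rewrite sqr_sqrtr.
have p_decr i : p i.+1 <= p i.
  rewrite ler_sqrt// (le_trans _ (g_step i))// lerDl.
  by rewrite mulr_ge0// exprn_ge0// sqrtr_ge0.
have p_le0 i : p i <= p 0%N.
  by elim: i => // i; apply: le_trans.
have den_gt0 i : 0 < 2 + 3 * kappa * p i.
  by rewrite ltr_pwDl// !mulr_ge0.
(* 1/p grows by at least kappa / (2 + 3 kappa p_i) at step i, and this is least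
   at i = 0 because p decreases. *)
pose c := kappa / (2 + 3 * kappa * p 0%N).
have c_ge0 : 0 <= c by rewrite divr_ge0// ltW.
have p_step i : p i.+1 * (1 + c * p i) <= p i.
  have h := gap_step_bound i; rewrite {1}(gE i.+1) {1}(gE i) in h.
  apply: le_trans (sqrt_step_decrease kappa_ge0 (p_ge0 i) (p_ge0 _) h).
  rewrite ler_wpM2l// lerD2l mulrAC ler_wpM2l ?mulr_ge0//.
  by rewrite lef_pV2 ?posrE// lerD2l ler_wpM2l// mulr_ge0.
have := harmonic_decay c_ge0 p_ge0 p_step k.
have -> : c * p 0%N = kappa * p 0%N / (2 + 3 * kappa * p 0%N) by rewrite mulrAC.
rewrite -/(p 0%N); set r := _ / _ => h.
have r_ge0 : 0 <= r by rewrite divr_ge0 ?mulr_ge0// ltW.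
have D_gt0 : 0 < 1 + k%:R * r by rewrite ltr_pwDl// mulr_ge0.
by rewrite ler_pdivlMr ?exprn_gt0// !gE -exprMn ler_pXn2r ?nnegrE ?mulr_ge0// ltW.
Qed.

End GapRates.

(** * Fractional powers and orders of magnitude *)

Section FractionalPowers.
Context (R : realType).

Lemma powR_half (a : R) : 0 <= a -> a `^ (1 / 2) = Num.sqrt a.
Proof. by move=> a0; rewrite div1r powR12_sqrt. Qed.

Lemma powR_three_halves (a : R) : 0 <= a -> a `^ (3 / 2) = Num.sqrt a ^+ 3.
Proof.
by move=> a0; rewrite mulrC powRrM powR12_sqrt// powR_mulrn// sqrtr_ge0.
Qed.

Lemma powR_two_thirds_expr3 (a : R) : 0 <= a -> (a ^+ 3) `^ (2 / 3) = a ^+ 2.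
Proof.
move=> a0; rewrite -powR_mulrn// -powRrM.
have -> : 3%:R * (2 / 3) = 2%:R :> R by field.
by rewrite powR_mulrn.
Qed.

(** The inequality w^(3/2) M^(1/2) <= 8 Y raised to the power 2/3; the 4 is
    8^(2/3). *)
Lemma le_of_sqrt_expr3_le (M Y w : R) :
    0 < M -> 0 <= Y -> 0 <= w -> Num.sqrt w ^+ 3 * Num.sqrt M <= 8 * Y ->
  w <= 4 / M `^ (1 / 3) * Y `^ (2 / 3).
Proof.
move=> M0 Y0 w0 hle.
rewrite mulrAC ler_pdivlMr ?powR_gt0//.
have -> : 4 = 8 `^ (2 / 3) :> R.
  by rewrite (_ : 8 = 2 ^+ 3 :> R) ?powR_two_thirds_expr3// -natrX.
have -> : M `^ (1 / 3) = Num.sqrt M `^ (2 / 3).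
  by rewrite -powR12_sqrt ?(ltW M0)// -powRrM; congr (_ `^ _); field.
rewrite -{1}(sqr_sqrtr w0) -powR_two_thirds_expr3 ?sqrtr_ge0//.
rewrite -!powRM ?exprn_ge0 ?sqrtr_ge0//.
by rewrite ge0_ler_powR ?nnegrE ?divr_ge0 ?mulr_ge0 ?exprn_ge0 ?sqrtr_ge0.
Qed.

End FractionalPowers.

Lemma bigO_inverse_square (R : realType) (u : nat -> R) (C : R) :
    (forall k, (0 < k)%N -> 0 <= u k <= C / k%:R ^+ 2) ->
  (u : nat -> R^o) =O_\oo (fun k : nat => 1 / k%:R ^+ 2 : R^o).
Proof.
move=> hu; apply/eqO_exP; exists (`|C| + 1); first by rewrite ltr_wpDl.
near=> k.
have k_gt0 : (0 < k)%N by near: k; exists 1%N.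
have /andP[u_ge0 u_le] := hu k k_gt0.
rewrite (ger0_norm u_ge0) div1r [X in _ * X]ger0_norm ?invr_ge0 ?exprn_ge0//.
rewrite (le_trans u_le)// ler_wpM2r ?invr_ge0 ?exprn_ge0//.
by rewrite (le_trans (ler_norm _))// lerDl.
Unshelve. all: by end_near. Qed.

Lemma inverse_square_bigO (R : realType) (G r : R) : 0 <= G -> 0 < r ->
  ((fun k : nat => G / (1 + k%:R * r) ^+ 2) : nat -> R^o)
    =O_\oo (fun k : nat => 1 / k%:R ^+ 2 : R^o).
Proof.
move=> G_ge0 r_gt0.
apply: (@bigO_inverse_square _ _ (G / r ^+ 2)) => k k_gt0.
have kr_gt0 : 0 < k%:R * r by rewrite mulr_gt0// ltr0n.
have den_gt0 : 0 < 1 + k%:R * r by rewrite addr_gt0.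
rewrite divr_ge0 ?exprn_ge0 ?(ltW den_gt0)//=.
rewrite -mulrA -invfM -exprMn ler_wpM2l// [r * _]mulrC.
rewrite lef_pV2 ?posrE ?exprn_gt0//.
by rewrite ler_pXn2r ?nnegrE ?(ltW den_gt0) ?(ltW kr_gt0)// lerDr.
Qed.

(** The base is of order 1/k^3, and 3 * (2/3) = 2. *)
Lemma inverse_cube_powR_bigO (R : realType) (c G r : R) :
    0 <= c -> 0 <= G -> 0 < r ->
  ((fun k : nat => c * (G / (k%:R * (2 + k%:R * r) ^+ 2)) `^ (2 / 3))
     : nat -> R^o) =O_\oo (fun k : nat => 1 / k%:R ^+ 2 : R^o).
Proof.
move=> c_ge0 G_ge0 r_gt0.
apply: (@bigO_inverse_square _ _ (c * (G / r ^+ 2) `^ (2 / 3))) => k k_gt0.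
have k_gt0' : 0 < k%:R :> R by rewrite ltr0n.
have kr_gt0 : 0 < k%:R * r by rewrite mulr_gt0.
have den_gt0 : 0 < 2 + k%:R * r by rewrite addr_gt0.
rewrite mulr_ge0 ?powR_ge0//= -[leRHS]mulrA ler_wpM2l//.
have -> : (k%:R ^+ 2)^-1 = ((k%:R ^+ 3)^-1) `^ (2 / 3) :> R.
  by rewrite -!exprVn powR_two_thirds_expr3 ?invr_ge0.
have cube_le : k%:R * (k%:R * r) ^+ 2 <= k%:R * (2 + k%:R * r) ^+ 2.
  rewrite ler_wpM2l// ler_pXn2r ?nnegrE ?(ltW den_gt0) ?(ltW kr_gt0)//.
  by rewrite lerDr.
rewrite -powRM ?divr_ge0 ?invr_ge0 ?exprn_ge0 ?(ltW r_gt0)//.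
have -> : G / r ^+ 2 / k%:R ^+ 3 = G / (k%:R * (k%:R * r) ^+ 2).
  by field; rewrite !gt_eqF.
have inv_le : G / (k%:R * (2 + k%:R * r) ^+ 2) <= G / (k%:R * (k%:R * r) ^+ 2).
  by rewrite ler_wpM2l// lef_pV2// posrE mulr_gt0 ?exprn_gt0.
apply: ge0_ler_powR inv_le => //; rewrite nnegrE divr_ge0// mulr_ge0//;
  exact: sqr_ge0.
Qed.

(** * Runs of the large-step method with exact subgradients *)

Section Run.
Context (R : realType) (H : completeNormedModType R).
Context (inner : {dot H for idfun}) (hinner : induces_norm inner).
Context (f : H -> \bar R) (fproper : proper_function f).
Context (x0 : H) (hx0 : x0 \in dom f).
Context (sigma theta : R) (hsigma : 0 <= sigma < 1) (htheta : 0 < theta).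
Context (x v : nat -> H) (eps lam : nat -> R).
Context (hrun : infinite_large_step_run inner f x0 sigma theta x v eps lam).
Context (hD0 : (sublevel_diameter f x0 < +oo)%E).
Context (heps : forall k : nat, (1 <= k)%N -> eps k = 0).
Context (xbar : H) (hxbar : minimizer f xbar).

Local Notation D0 := (fine (sublevel_diameter f x0)).
Local Notation phi k := (fine (f (x k))).
Local Notation phibar := (fine (f xbar)).
Local Notation gap k := (fine (f (x k) - f xbar)%E).
Local Notation m := (Num.sqrt (theta * (1 - sigma))).

Lemma value_iterateE k : f (x k) = (phi k)%:E.
Proof.
rewrite fineK// fin_numElt fproper.1 /=.
case: k => [|k]; first by rewrite (run_start hrun); exact: set_mem hx0.
by have /set_mem[/set_mem] := run_subgradient hrun (ltn0Sn k).
Qed.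

Lemma value_minimizerE : f xbar = phibar%:E.
Proof.
rewrite fineK// fin_numElt fproper.1 /=.
by rewrite (le_lt_trans (hxbar (x 0%N)))// value_iterateE ltry.
Qed.

Lemma gapE k : gap k = phi k - phibar.
Proof. by rewrite value_iterateE value_minimizerE. Qed.

Lemma gap_ge0 k : 0 <= gap k.
Proof.
by have := hxbar (x k); rewrite gapE subr_ge0 value_iterateE value_minimizerE lee_fin.
Qed.

Lemma subgradient_ineq k y (a : R) : f y = a%:E ->
  phi k.+1 + inner (v k.+1) (y - x k.+1) <= a.
Proof.
move=> fy; have /set_mem[_ /(_ y)] := run_subgradient hrun (ltn0Sn k).
by rewrite fy heps// value_iterateE sube0 -EFinD lee_fin.
Qed.

Lemma iterate_error k :
  `|lam k.+1 *: v k.+1 - (x k - x k.+1)| ^+ 2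
    <= sigma ^+ 2 * `|x k - x k.+1| ^+ 2.
Proof.
have := run_error hrun (ltn0Sn k).
by rewrite heps// mulr0 addr0 opprB addrA (distrC (x k)).
Qed.

Lemma iterate_large_step k : theta <= lam k.+1 * `|x k - x k.+1|.
Proof.
rewrite distrC; have [//|/(run_never_stops hrun (ltn0Sn k))[]] :=
  run_large_step hrun (ltn0Sn k).
Qed.

Lemma gap_decrease k : gap k.+1 + m * Num.sqrt `|v k.+1| ^+ 3 <= gap k.
Proof.
have := large_step_decrease hinner hsigma htheta
  (run_step_gt0 hrun (ltn0Sn k)) (iterate_error k) (iterate_large_step k).
have := subgradient_ineq k (value_iterateE k).
rewrite !gapE; lra.
Qed.

Lemma decrease_factor_gt0 : 0 < m.
Proof. by case/andP: hsigma => _ ?; rewrite sqrtr_gt0 mulr_gt0// subr_gt0. Qed.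

(** A vanishing gap would leave no room for the decrease of the next step,
    which is positive because the run never meets a zero subgradient. *)
Lemma gap_gt0 k : 0 < gap k.
Proof.
rewrite (lt_le_trans _ (gap_decrease k))// ltr_wpDl ?gap_ge0// mulr_gt0 ?decrease_factor_gt0//.
rewrite exprn_gt0// sqrtr_gt0 normr_gt0; apply/eqP.
exact: (run_never_stops hrun (ltn0Sn k)).
Qed.

Lemma iterate_sublevel k : (f (x k) <= f x0)%E.
Proof.
rewrite -(run_start hrun) (value_iterateE k) (value_iterateE 0%N) lee_fin.
have : gap k <= gap 0%N.
  elim: k => // k; apply: le_trans; rewrite (le_trans _ (gap_decrease k))// lerDl.
  by rewrite mulr_ge0 ?(ltW decrease_factor_gt0)// exprn_ge0// sqrtr_ge0.
rewrite !gapE; lra.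
Qed.

Lemma dist_le_diameter y z : (f y <= f x0)%E -> (f z <= f x0)%E ->
  `|y - z| <= D0.
Proof.
move=> fy fz.
have le_sup : (`|y - z|%:E <= sublevel_diameter f x0)%E.
  apply: ereal_sup_ubound; exists (y, z) => //=.
  by rewrite ge_max fy fz.
rewrite -lee_fin fineK// fin_numElt hD0 andbT.
by rewrite (lt_le_trans _ le_sup)// ltNyr.
Qed.

(** The first two iterates lie in the sublevel set, and the large-step condition
    keeps them apart. *)
Lemma diameter_gt0 : 0 < D0.
Proof.
apply: lt_le_trans (dist_le_diameter (iterate_sublevel 0%N) (iterate_sublevel 1%N)).
have := iterate_large_step 0; rewrite leNgt; apply: contraR.
rewrite normr_gt0 negbK => /eqP ->.
by rewrite normr0 mulr0.
Qed.

Lemma gap_le_subgradient k : gap k.+1 <= `|v k.+1| * D0.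
Proof.
have := subgradient_ineq k value_minimizerE.
have : - inner (v k.+1) (xbar - x k.+1) <= `|v k.+1| * D0.
  rewrite -linearNr opprB (le_trans (inner_le_norm hinner _ _))//.
  by rewrite ler_wpM2l// dist_le_diameter ?iterate_sublevel.
rewrite gapE; lra.
Qed.

(** The bound of [gap_le_subgradient] turns the decrease measured by the next
    subgradient into one measured by the next gap; the factor is
    sqrt(theta (1 - sigma)) / D0^(3/2). *)
Lemma gap_recursion k :
  gap k.+1 + Num.sqrt (theta * (1 - sigma) / D0 ^+ 3) * Num.sqrt (gap k.+1) ^+ 3
    <= gap k.
Proof.
apply: le_trans (gap_decrease k); rewrite lerD2l.
have D_gt0 := diameter_gt0; have D_ge0 := ltW D_gt0.
have th_ge0 : 0 <= theta * (1 - sigma).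
  by case/andP: hsigma => _ s1; rewrite mulr_ge0 ?subr_ge0 ?ltW.
have -> : Num.sqrt (theta * (1 - sigma) / D0 ^+ 3) = m / Num.sqrt D0 ^+ 3.
  rewrite sqrtrM// sqrtrV ?exprn_ge0// -{1}(sqr_sqrtr D_ge0) -exprM mulnC exprM.
  by rewrite sqrtr_sqr ger0_norm// exprn_ge0// sqrtr_ge0.
rewrite mulrAC ler_pdivrMr ?exprn_gt0 ?sqrtr_gt0// -mulrA -exprMn.
rewrite ler_wpM2l ?(ltW decrease_factor_gt0)// ler_pXn2r ?nnegrE ?mulr_ge0 ?sqrtr_ge0//.
by rewrite -sqrtrM// ler_wsqrtr// gap_le_subgradient.
Qed.

End Run.

Unset Implicit Arguments.
Set Strict Implicit.

Theorem theorem6p4 (R : realType) (H : completeNormedModType R)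
  (inner : {dot H for idfun}) (hinner : induces_norm inner)
  (f : H -> \bar R) (fproper : proper_function f) (fclosed : closed_function f)
  (fconvex : convex_extended f)
  (x0 : H) (hx0 : x0 \in dom f)
  (sigma theta : R) (hsigma : 0 <= sigma < 1) (htheta : 0 < theta)
  (x v : nat -> H) (eps lam : nat -> R)
  (hrun : infinite_large_step_run inner f x0 sigma theta x v eps lam)
  (hD0 : (sublevel_diameter f x0 < +oo)%E)
  (heps : forall k : nat, (1 <= k)%N -> eps k = 0)
  (xbar : H) (hxbar : minimizer f xbar) :
  let D0 : R := fine (sublevel_diameter f x0) in
  let kappa0 : R := Num.sqrt (theta * (1 - sigma) / D0 ^+ 3) in
  (* f (x k) - f xbar, a real number since x k and xbar lie in dom f *)
  let gap (k : nat) : R := fine (f (x k) - f xbar)%E in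
  let rate : R :=
    kappa0 * Num.sqrt (gap 0%N) / (2 + 3 * kappa0 * Num.sqrt (gap 0%N)) in
  let value_bound (k : nat) : R := gap 0%N / (1 + k%:R * rate) ^+ 2 in
  let subgradient_bound (k : nat) : R :=
    4 / (theta * (1 - sigma)) `^ (1 / 3)
      * (gap 0%N / (k%:R * (2 + k%:R * rate) ^+ 2)) `^ (2 / 3) in
  [/\ forall k : nat, (1 <= k)%N ->
        (f (x k) - f xbar <= (`|v k| * D0)%:E)%E,
      forall k : nat, (1 <= k)%N ->
        (f (x k) <= f (x k.-1) -
           (2 * kappa0 * gap k.-1 `^ (3 / 2)
              / (2 + 3 * kappa0 * gap k.-1 `^ (1 / 2)))%:E)%E,
      (forall k : nat, (1 <= k)%N -> (f (x k) - f xbar <= (value_bound k)%:E)%E)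
        /\ ((value_bound : nat -> R^o) =O_\oo (fun k : nat => 1 / k%:R ^+ 2 : R^o))
    & (forall k : nat, (2 <= k)%N -> ~~ odd k ->
         exists j : nat, (k./2 + 1 <= j <= k)%N /\ `|v j| <= subgradient_bound k)
        /\ ((subgradient_bound : nat -> R^o)
             =O_\oo (fun k : nat => 1 / k%:R ^+ 2 : R^o))].
Proof.
move=> D0 kappa0 gap rate value_bound subgradient_bound.
have hsig : 0 < 1 - sigma by case/andP: hsigma => _; rewrite subr_gt0.
have M_gt0 : 0 < theta * (1 - sigma) by rewrite mulr_gt0.
have D_gt0 : 0 < D0.
  exact: (diameter_gt0 hinner fproper hx0 hsigma htheta hrun hD0 heps hxbar).
have gap_gt0 k : 0 < gap k.
  exact: (gap_gt0 hinner fproper hx0 hsigma htheta hrun heps hxbar).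
have gap_ge0 k : 0 <= gap k by exact: ltW.
have gap_rec :=
  gap_recursion hinner fproper hx0 hsigma htheta hrun hD0 heps hxbar.
have fE k : f (x k) = (gap k + fine (f xbar))%:E.
  rewrite (value_iterateE fproper hx0 hrun) /gap.
  by rewrite (gapE fproper hx0 hrun hxbar) subrK.
have gapE k : (f (x k) - f xbar)%E = (gap k)%:E.
  rewrite (fE k) (value_minimizerE fproper hx0 hrun hxbar).
  by rewrite -EFinB addrK.
have kappa_gt0 : 0 < kappa0 by rewrite sqrtr_gt0 divr_gt0// exprn_gt0.
have kappa_ge0 := ltW kappa_gt0.
have sg_gt0 : 0 < Num.sqrt (gap 0%N) by rewrite sqrtr_gt0.
have rate_gt0 : 0 < rate.
  by rewrite divr_gt0 ?mulr_gt0// ltr_pwDl// ltW// !mulr_gt0.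
have rate_ge0 := ltW rate_gt0.
have gap_rate := gap_rate_bound kappa_ge0 gap_ge0 gap_rec.
have den_gt0 (a : R) k : 0 < a -> 0 < a + k%:R * rate.
  by move=> a0; rewrite ltr_pwDl// mulr_ge0.
split.
- case=> // k _; rewrite gapE lee_fin.
  exact: (gap_le_subgradient hinner fproper hx0 hsigma htheta hrun hD0 heps hxbar).
- case=> // k _ /=; rewrite powR_half// powR_three_halves//.
  have := gap_step_bound kappa_ge0 gap_ge0 gap_rec k.
  rewrite (fE k.+1) (fE k) -EFinB lee_fin; lra.
- split; first by move=> k _; rewrite gapE lee_fin gap_rate.
  exact: inverse_square_bigO.
- split.
    move=> k k_ge2 k_even.
    have kE : k = (k./2 + k./2)%N by rewrite addnn even_halfK.
    have h_gt0 : (0 < k./2)%N by rewrite half_gt0.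
    have [j [hj hs]] := exists_small_decrement
      (s := fun i => Num.sqrt (theta * (1 - sigma)) * Num.sqrt `|v i| ^+ 3)
      k./2 h_gt0 gap_ge0
      (gap_decrease hinner fproper hx0 hsigma htheta hrun heps hxbar).
    exists j; split; first by rewrite -kE in hj.
    have h_gt0' : 0 < k./2%:R :> R by rewrite ltr0n.
    have den1_gt0 := den_gt0 _ k./2 ltr01.
    apply: le_of_sqrt_expr3_le => //.
      by rewrite divr_ge0// mulr_ge0// exprn_ge0// ltW// den_gt0.
    (* With k = 2h, the bound on the gap at step h is 4 gap 0 / (2 + k rate)^2, and
       dividing by h = k/2 produces the 8 of [le_of_sqrt_expr3_le]. *)
    rewrite mulrC -(ler_pM2l h_gt0') (le_trans hs)// (le_trans (gap_rate _))//.
    rewrite -/rate -/kappa0 -/(gap 0%N).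
    have -> : k%:R = 2 * k./2%:R :> R by rewrite {1}kE natrD mulr_natl mulr2n.
    rewrite le_eqVlt; apply/orP; left; apply/eqP; field.
    by rewrite !gt_eqF//; lra.
  by apply: inverse_cube_powR_bigO; rewrite ?divr_ge0 ?powR_ge0.
Qed.
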